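(* Let $a$ be a fixed even positive integer. For each positive integer $n$, let $n$ mobile sensors be placed independently and uniformly at random in $[0,1]$, let $X_1\le X_2\le\dots\le X_n$ be their positions in increasing order (so $X_i$ is the $i$-th order statistic), and let $t_i=\frac{i}{n}-\frac{1}{2n}$ for $i=1,\dots,n$. Then the expected sum of displacements to the power $a$ when the $i$-th sensor moves from $X_i$ to the anchor location $t_i$, for $i=1,\dots,n$, satisfies $$\sum_{i=1}^{n}\mathbf{E}\left[|X_i-t_i|^a\right]=\frac{\left(\frac{a}{2}\right)!}{2^{\frac{a}{2}}(1+a)}\,\frac{1}{n^{\frac{a}{2}-1}}+O\left(\frac{1}{n^{\frac{a}{2}}}\right)\qquad (n\to\infty).$$
   Context: The implied constant in $O(\cdot)$ may depend on $a$ but not on $n$. *)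

(* Defs.v *)
From HB Require Import structures.
From mathcomp Require Import all_boot all_order all_algebra.
From mathcomp Require Import all_classical all_reals all_analysis.

Set Implicit Arguments.
Unset Strict Implicit.
Unset Printing Implicit Defensive.

Import Order.TTheory GRing.Theory Num.Theory.
Import numFieldNormedType.Exports.

Local Open Scope classical_set_scope.
Local Open Scope ring_scope.

Definition mutually_independent (d : measure_display) (T : measurableType d)
    (R : realType) (P : probability T R) (n : nat)
    (Y : 'I_n -> {RV P >-> R}) : Prop :=
  forall (J : {set 'I_n}) (A : 'I_n -> set R),
    (forall i, measurable (A i)) ->
    P (\bigcap_(i in [set` J]) (Y i @^-1` A i)) =
    (\prod_(i in J) P (Y i @^-1` A i))%E.

(* The laws are compared on Borel sets only: [distribution] and [uniform_prob]
   also return values on non-measurable sets, which carry no meaning. *)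
Definition uniform01 (d : measure_display) (T : measurableType d)
    (R : realType) (P : probability T R) (Y : {RV P >-> R}) : Prop :=
  forall A : set R, measurable A ->
    distribution P Y A = uniform_prob (@ltr01 R) A.

(* The i-th smallest of Y_0(w), ..., Y_(n-1)(w), counted with multiplicity;
   i is 1-based and meaningful for 1 <= i <= n. *)
Definition order_stat (T : Type) (R : realType) (n : nat)
    (Y : 'I_n -> T -> R) (i : nat) (w : T) : R :=
  nth 0 (sort <=%R [seq Y j w | j <- enum 'I_n]) i.-1.

(* 1-based, as in [order_stat]. *)
Definition anchor (R : realType) (n i : nat) : R :=
  i%:R / n%:R - 1 / (2 * n%:R).

Definition expected_displacement (d : measure_display) (T : measurableType d)
    (R : realType) (P : probability T R) (a n : nat)
    (Y : 'I_n -> {RV P >-> R}) : \bar R :=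
  (\sum_(1 <= i < n.+1)
     'E_P[fun w => (`|order_stat (fun j => Y j : T -> R) i w - anchor R n i|
                      ^+ a)%R])%E.

(* Main.v *)
Require Import Defs.
From HB Require Import structures.
From mathcomp Require Import all_boot all_order all_algebra.
From mathcomp Require Import all_classical all_reals all_analysis.
From mathcomp Require Import measurable_realfun ring lra.

Import Order.TTheory GRing.Theory Num.Theory.
Import numFieldNormedType.Exports.

Local Open Scope classical_set_scope.
Local Open Scope ring_scope.

(* Let F x be the proportion of sensors in [0, x]. Exchanging the roles of the
   two axes, the integral of (F x - x)^a over [0, 1] is the sum over i of the
   integrals of (X_i - u)^a over the cells [(i-1)/n, i/n]. As the anchor t_i is
   the midpoint of the i-th cell, n times the integral over that cell exceeds
   (X_i - t_i)^a by O(n^-2 ((X_i - t_i)^(a-2) + n^(2-a))) only. In expectation,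
   Tonelli turns the left-hand side into the integral over x of the a-th
   central moment of a binomial(n, x) variable, divided by n^a; the recurrence
   mu_(s+1) = x (1 - x) (mu_s' + n s mu_(s-1)) shows that this moment is a
   polynomial in n of degree a/2 with leading coefficient
   (a-1)!! (x (1 - x))^(a/2), whose integral is a beta function. *)

(** * Central moments of the binomial law, as polynomials in x and in n *)

(* The s-th central moment of a binomial(n, 'X) variable: S is the set of
   successful trials. *)
Definition cmoment (R : numFieldType) (n s : nat) : {poly R} :=
  \sum_(S : {set 'I_n})
    'X^#|S| * (1 - 'X) ^+ (n - #|S|) * (#|S|%:R - n%:R * 'X) ^+ s.

Lemma mulX_derivXn (R : numFieldType) k : 'X * ('X^k)^`() = k%:R * 'X^k :> {poly R}.
Proof.
rewrite derivXn; case: k => [|k] /=; first by rewrite mulr0n mulr0 mul0r.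
by rewrite exprS mulrnAr mulr_natl.
Qed.

Lemma mul1BX_deriv1BXn (R : numFieldType) k :
  (1 - 'X) * ((1 - 'X) ^+ k)^`() = - (k%:R * (1 - 'X) ^+ k) :> {poly R}.
Proof.
rewrite deriv_exp derivB derivX derivC; case: k => [|k] /=.
  by rewrite !mulr0n mulr0 mul0r oppr0.
by rewrite exprS; ring.
Qed.

(** Differentiate term by term, with W = k - n x. Multiplied by x (1 - x), the derivative of x^k (1
    - x)^(n-k) is the same product times W, which gives the next moment; the derivative of W^s
    brings -n s W^(s-1), which the second summand cancels. *)
Lemma cmomentS (R : numFieldType) n s :
  cmoment R n s.+1 = 'X * (1 - 'X) *
    ((cmoment R n s)^`() + n%:R * (s%:R * cmoment R n s.-1)).
Proof.
rewrite /cmoment raddf_sum !mulr_sumr -big_split mulr_sumr /=.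
apply: eq_bigr => S _; set k := #|S|.
have kn : (k <= n)%N by rewrite -[leqRHS]card_ord max_card.
(* Writing n = k + l removes the truncated subtraction, so that [ring] can conclude. *)
have [l ->] : exists l, n = (k + l)%N by exists (n - k)%N; rewrite subnKC.
rewrite addKn natrD; set W : {poly R} := _ - _ * _.
have W' : (W ^+ s)^`() = - (k%:R + l%:R) * (s%:R * W ^+ s.-1).
  rewrite deriv_exp /W derivB derivM derivX -!natrD !derivMn derivC mulr1.
  by rewrite !mul0rn -mulr_natl; ring.
rewrite !derivM W' mulrDr.
have -> : 'X * (1 - 'X) * ((('X^k)^`() * (1 - 'X) ^+ l + 'X^k * ((1 - 'X) ^+ l)^`()) *
  W ^+ s + 'X^k * (1 - 'X) ^+ l * (- (k%:R + l%:R) * (s%:R * W ^+ s.-1))) =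
  (('X * ('X^k)^`()) * (1 - 'X) * (1 - 'X) ^+ l
    + 'X^k * ((1 - 'X) * ((1 - 'X) ^+ l)^`()) * 'X) * W ^+ s
   + 'X * (1 - 'X) * ('X^k * (1 - 'X) ^+ l * (- (k%:R + l%:R) * (s%:R * W ^+ s.-1)))
   :> {poly R} by ring.
rewrite mulX_derivXn mul1BX_deriv1BXn exprS /W; ring.
Qed.

(** Expansion of (x + (1 - x))^n over the subsets of the trials. *)
Lemma cmoment0 (R : numFieldType) n : cmoment R n 0 = 1.
Proof.
transitivity (\prod_(i < n) ('X + (1 - 'X)) : {poly R}); last first.
  by rewrite big1 // => i _; ring.
rewrite bigA_distr.
apply: eq_bigr => S _.
rewrite expr0 mulr1 big_if /= !prodr_const; congr (_ * _ ^+ _).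
transitivity (#|S| + #|~: S| - #|S|)%N; first by rewrite cardsC card_ord.
by rewrite addKn; apply: eq_card => i; rewrite !inE.
Qed.

Lemma cmoment1 (R : numFieldType) n : cmoment R n 1 = 0.
Proof. by rewrite cmomentS cmoment0 derivC mul0r mulr0 addr0 mulr0. Qed.

(** The odd double factorial (2m - 1)!!, equal to 1 at m = 0. *)
Definition double_fact (m : nat) : nat := \prod_(i < m) (i.*2.+1).

Lemma double_factE m : (double_fact m * (2 ^ m * m`!) = m.*2`!)%N.
Proof.
rewrite /double_fact; elim: m => [|m IH]; first by rewrite big_ord0.
rewrite big_ord_recr /= doubleS !factS expnS -IH.
move: (\prod_(i < m) _)%N (2 ^ m)%N m`! => u v w.
rewrite -muln2; ring.
Qed.

(** The derivative is taken in the inner variable, for which n is a constant, so it acts on the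
    coefficients alone. *)
Lemma deriv_horner_natr (R : numFieldType) (q : {poly {poly R}}) n :
  q.[n%:R]^`() = (map_poly (@deriv R) q).[n%:R].
Proof.
rewrite horner_coef (horner_coef_wide _ (size_poly _ _)) raddf_sum /=.
apply: eq_bigr => i _; rewrite coef_map_id0 ?raddf0 // derivM -natrX.
by rewrite derivMn derivC mul0rn mulr0 addr0.
Qed.

(** The outer variable of [q] stands for n and its coefficients are polynomials in x. The recurrence
    gains one power of n every two steps, hence the degree s/2. *)
Lemma cmoment_poly (R : numFieldType) s : exists q : {poly {poly R}},
  [/\ (size q <= s./2.+1)%N,
      ~~ odd s -> q`_s./2 = (double_fact s./2)%:R * ('X * (1 - 'X)) ^+ s./2 &
      forall n, cmoment R n s = q.[n%:R]].
Proof.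
pose P s := exists q : {poly {poly R}},
  [/\ (size q <= s./2.+1)%N,
      ~~ odd s -> q`_s./2 = (double_fact s./2)%:R * ('X * (1 - 'X)) ^+ s./2 &
      forall n, cmoment R n s = q.[n%:R]].
(* The recurrence reaches back two moments, so the induction carries two consecutive ones. *)
suff : P s /\ P s.+1 by case.
elim: s => [|s [[q0 [sq0 lq0 eq0]] [q1 [sq1 lq1 eq1]]]].
  split.
    exists 1; split; first by rewrite size_poly1.
      by rewrite coef1 /double_fact big_ord0 expr0 mulr1.
    by move=> n; rewrite cmoment0 hornerE.
  exists 0; split => //; first by rewrite size_poly0.
  by move=> n; rewrite cmoment1 hornerE.
split; first by exists q1.
(* This transcribes [cmomentS]: the derivative in x becomes a map on coefficients, and
   multiplication by n becomes the outer ['X]. *)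
exists (('X * (1 - 'X)) *: (map_poly (@deriv R) q1 + 'X * (s.+1%:R *: q0))).
have sX0 : (size ('X * (s.+1%:R *: q0))%R <= s./2.+2)%N.
  rewrite mulrC; apply: leq_trans (size_polyMleq _ _) _; rewrite size_polyX addn2 /=.
  by rewrite ltnS (leq_trans (size_scale_leq _ _)).
split.
- apply: leq_trans (size_scale_leq _ _) _ => /=.
  rewrite (leq_trans (size_polyD _ _))// geq_max (leq_trans (size_poly _ _)) ?sX0 //.
  by rewrite (leq_trans sq1) // ltnS /= uphalf_half; case: odd; rewrite ?add1n // ltnW.
(* For even s the size of [q1] leaves no coefficient of index s/2 + 1, so the top coefficient comes
   from [q0] alone; the factor s + 1 is the next odd factor of the double factorial. *)
- rewrite /= negbK => s_ev; rewrite coefZ coefD coefXM /= coefZ lq0 //.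
  rewrite coef_map_id0 ?raddf0 // nth_default ?raddf0 ?add0r; last first.
    by apply: leq_trans sq1 _; rewrite /= uphalf_half (negbTE s_ev) add0n.
  rewrite /double_fact big_ord_recr /= exprS natrM.
  have -> : (s./2).*2.+1 = s.+1 by rewrite -[in RHS](odd_double_half s) (negbTE s_ev).
  ring.
- move=> n; rewrite cmomentS eq1 eq0 /= hornerZ hornerD hornerM hornerX hornerZ.
  congr (_ * (_ + _)).
  exact: deriv_horner_natr.
Qed.

(** * The mean of an even power over an interval, compared with its value at the centre *)

(* The mean of u |-> u ^+ b over the interval of centre y and radius h. *)
Definition cell_mean (R : numFieldType) (b : nat) (y h : R) : R :=
  ((y + h) ^+ b.+1 - (y - h) ^+ b.+1) / (2 * h * b.+1%:R).


(* For A = y^2, B = h^2 and odd k = 2i+1, the sequences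
   s i = ((y+h)^k - (y-h)^k) / (2h) and t i = y ((y+h)^k + (y-h)^k) / 2 satisfy
   these recurrences. *)
Lemma cell_recurrence_bound (R : realFieldType) (m : nat) :
  exists2 K : R, 0 <= K & forall (A B : R) (s t : nat -> R), 0 <= A -> 0 <= B ->
    s 0%N = 1 -> t 0%N = A ->
    (forall i, s i.+1 = (A + B) * s i + 2 * t i) ->
    (forall i, t i.+1 = (A + B) * t i + 2 * A * B * s i) ->
    [/\ (m.+1.*2.+1)%:R * A ^+ m.+1 <= s m.+1,
        s m.+1 <= (m.+1.*2.+1)%:R * A ^+ m.+1 + K * B * (A + B) ^+ m,
        A ^+ m.+2 <= t m.+1 &
        t m.+1 <= A ^+ m.+2 + K * B * (A + B) ^+ m.+1].
Proof.
elim: m => [|m [K K0 IH]].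
  exists 3 => // A B s t A0 B0 s0 t0 sS tS.
  have AB0 : 0 <= A * B by rewrite mulr_ge0.
  have BB0 : 0 <= B * B by rewrite mulr_ge0.
  rewrite sS tS s0 t0 !expr1 expr0 expr2 (_ : (1.*2.+1)%:R = 3 :> R) //.
  by split; lra.
(* The bound on [t] dictates this constant: (A + B) t contributes K and, through B A^(m+2), the 1;
   the term 2 A B s contributes 2 K and twice the coefficient 2m + 3. *)
exists (3 * K + 2 * (m.+1.*2.+1)%:R + 1); first by rewrite !addr_ge0 ?mulr_ge0 ?ler0n.
move=> A B s t A0 B0 s0 t0 sS tS.
have [ls us lt ut] := IH A B s t A0 B0 s0 t0 sS tS.
rewrite [s m.+2]sS [t m.+2]tS.
rewrite (_ : (m.+2.*2.+1)%:R = (m.+1.*2.+1)%:R + 2 :> R); last first.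
  by rewrite -natrD addn2.
move: ls us lt ut; move: (s m.+1) (t m.+1) => {s0 t0 sS tS}s1 t1.
move: s t s1 t1 => _ _ s t.
have N0 : 0 <= (m.+1.*2.+1)%:R :> R by rewrite ler0n.
move: (_%:R) N0 => N N0.
have Am0 : 0 <= A ^+ m.+1 by rewrite exprn_ge0.
have AS : A * A ^+ m.+1 = A ^+ m.+2 by rewrite -exprS.
have AmS : A ^+ m.+1 <= (A + B) ^+ m.+1 by rewrite ler_pXn2r ?nnegrE ?addr_ge0 // lerDl.
have DS : (A + B) ^+ m.+1 = (A + B) * (A + B) ^+ m by rewrite exprS.
have DSS : (A + B) ^+ m.+2 = (A + B) * (A + B) ^+ m.+1 by rewrite exprS.
have D0 : 0 <= (A + B) ^+ m by rewrite exprn_ge0 ?addr_ge0.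
have ASS : A ^+ m.+3 = A * A ^+ m.+2 by rewrite exprS.
rewrite ASS DSS -AS.
move: (A ^+ m.+1) Am0 AmS DS {AS ASS DSS} => a a0.
move: ((A + B) ^+ m.+1) ((A + B) ^+ m) D0 => c d d0 ac cE.
move=> ls us lt ut.
have AB : 0 <= A + B by rewrite addr_ge0.
(* The powers are now free variables; each product of inequalities is supplied by hand, so that the
   goals become linear in the monomials. *)
have Ba0 : 0 <= B * a by rewrite mulr_ge0.
have Bac : B * a <= B * c by rewrite ler_wpM2l.
have c0 : 0 <= c by apply: le_trans ac.
have KBc : 0 <= K * (B * c) by rewrite !mulr_ge0.
have NBac : N * (B * a) <= N * (B * c) by rewrite ler_wpM2l.
have NBc : 0 <= N * (B * c) by rewrite !mulr_ge0.
have h1 := ler_wpM2l AB ls.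
have h2 := ler_wpM2l AB us.
have h3 := ler_wpM2l AB lt.
have h4 := ler_wpM2l AB ut.
have s_ge0 : 0 <= s by apply: le_trans ls; rewrite mulr_ge0.
have KBc' : (A + B) * (K * B * d) = K * (B * c) by rewrite cE; ring.
have Bd0 : 0 <= A * d by rewrite mulr_ge0.
have sc : A * s <= N * ((A + B) * c) + K * ((A + B) * c).
  have -> : K * ((A + B) * c) = A * (K * c) + K * (B * c) by ring.
  have AKd : A * (K * B * d) <= A * (K * c).
    by rewrite -mulrA !ler_wpM2l // cE mulrDl lerDr.
  have ANa : A * (N * a) <= N * ((A + B) * c).
    have -> : A * (N * a) = N * (A * a) by ring.
    by rewrite ler_wpM2l // ler_pM // lerDl.
  have := ler_wpM2l A0 us; lra.
have NBa : 0 <= N * (B * a) by rewrite !mulr_ge0.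
have Aac : A * a <= (A + B) * c by rewrite ler_pM // lerDl.
have BAa : 0 <= A * (B * a) by rewrite !mulr_ge0.
have ABs : 0 <= A * B * s by rewrite !mulr_ge0.
split.
- lra.
- lra.
- lra.
- have := ler_wpM2l B0 sc; have := ler_wpM2l B0 Aac; lra.
Qed.

(** The lower bound is Jensen's inequality at the centre, the upper one its second-order defect.
    Both come from the recurrences at A = y^2 and B = h^2, divided by 2m + 3. *)
Lemma cell_mean_bounds (R : realFieldType) (m : nat) :
  exists2 K : R, 0 <= K & forall y h : R, 0 < h ->
    y ^+ m.+1.*2 <= cell_mean R m.+1.*2 y h <=
    y ^+ m.+1.*2 + K * h ^+ 2 * (y ^+ m.*2 + h ^+ m.*2).
Proof.
have [K K0 HK] := cell_recurrence_bound R m.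
have N0 : 0 < (m.+1.*2.+1)%:R :> R by rewrite ltr0n.
exists (K / (m.+1.*2.+1)%:R * 2 ^+ m).
  by rewrite mulr_ge0 ?divr_ge0 ?exprn_ge0 // ltW.
move=> y h h0.
pose s i := ((y + h) ^+ i.*2.+1 - (y - h) ^+ i.*2.+1) / (2 * h).
pose t i := y * ((y + h) ^+ i.*2.+1 + (y - h) ^+ i.*2.+1) / 2.
have A0 : 0 <= y ^+ 2 by rewrite sqr_ge0.
have B0 : 0 <= h ^+ 2 by rewrite sqr_ge0.
have hn0 : h != 0 by rewrite gt_eqF.
have [ | | | |] := HK _ _ s t A0 B0.
- by rewrite /s /= !expr1; field.
- by rewrite /t /= !expr1; field.
- by move=> i; rewrite /s /t doubleS !exprS; field.
- by move=> i; rewrite /s /t doubleS !exprS; field.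
have -> : cell_mean R m.+1.*2 y h = s m.+1 / (m.+1.*2.+1)%:R.
  by rewrite /cell_mean /s invfM mulrA.
rewrite -!exprM !mul2n => ls us _ _; rewrite ler_pdivlMr // ler_pdivrMr // mulrC ls /=.
apply: le_trans us _; rewrite [leRHS]mulrDl [y ^+ _ * _]mulrC lerD2l.
have -> : K / (m.+1.*2.+1)%:R * 2 ^+ m * h ^+ 2 *
    (y ^+ m.*2 + h ^+ m.*2) * (m.+1.*2.+1)%:R =
    K * h ^+ 2 * (2 ^+ m * (y ^+ m.*2 + h ^+ m.*2)) by field; rewrite gt_eqF.
rewrite ler_wpM2l ?mulr_ge0 ?(ltW h0) // -!mul2n !exprM.
move: (y ^+ 2) (h ^+ 2) A0 B0 => A B A0 B0.
(* By symmetry B is the larger, and (A + B)^m <= (2 B)^m <= 2^m (A^m + B^m). *)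
wlog AB : A B A0 B0 / A <= B => [th|].
  case: (leP A B) => [AB|/ltW BA]; first exact: th.
  by rewrite addrC [A ^+ m + _]addrC; exact: th.
rewrite -[leLHS]mul1r.
apply: (@le_trans _ _ ((2 * B) ^+ m)).
  by rewrite mul1r lerXn2r ?nnegrE ?addr_ge0 ?mulr_ge0 //; lra.
by rewrite exprMn ler_wpM2l ?exprn_ge0 // lerDr exprn_ge0.
Qed.

(** Adds to the lower bound the exponent 0, where the mean is 1. *)
Lemma cell_mean_ge (R : realFieldType) (b : nat) (y h : R) : ~~ odd b -> 0 < h ->
  y ^+ b <= cell_mean R b y h.
Proof.
rewrite -{2 3}(odd_double_half b) => /negbTE -> h0; case: b./2 => [|m].
  rewrite expr0 /cell_mean !expr1 mulr1 (_ : _ - _ = 2 * h) ?divff //; last by ring.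
  by rewrite mulf_neq0 ?gt_eqF // ltW.
have [K _ HK] := cell_mean_bounds R m.
by rewrite add0n; have /andP[] := HK y h h0.
Qed.

(** * Integration of powers of an empirical deviation *)

Lemma integral_itv_shifted_expr (R : realType) (b : nat) (c x y : R) : x <= y ->
  (\int[lebesgue_measure]_(t in `[x, y]) ((c - t) ^+ b)%:E =
   (((c - x) ^+ b.+1 - (c - y) ^+ b.+1) / b.+1%:R)%:E)%E.
Proof.
(* The fundamental theorem of calculus is applied for x < y; the one-point interval is treated
   apart. *)
rewrite le_eqVlt => /predU1P[->|xy].
  by rewrite set_itv1 integral_set1 subrr mul0r.
pose F (t : R) := - ((c - t) ^+ b.+1 / b.+1%:R).
have dX n (t : R) :
    is_derive t (1 : R) (fun u : R => (c - u) ^+ n) (- n%:R * (c - t) ^+ n.-1).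
  have -> : (fun u : R => (c - u) ^+ n) = (cst c - id) ^+ n.
    by apply/funext => u; rewrite exprfctE.
  by apply: is_derive_eq; rewrite /= sub0r scalerN scaler1 mulNr.
have dF (t : R) : is_derive t (1 : R) F ((c - t) ^+ b).
  have -> : F = (- b.+1%:R^-1) \*: (fun u : R => (c - u) ^+ b.+1).
    by apply/funext => u; rewrite /F /= mulrC -mulNr.
  by apply: is_derive_eq; rewrite /= -[LHS]/(_ * _) mulrA mulrNN mulVf ?mul1r ?pnatr_eq0.
have cF (f df : R -> R) :
    (forall t, is_derive t (1 : R) f (df t)) -> continuous f.
  by move=> h t; apply: differentiable_continuous; apply/derivable1_diffP; have [] := h t.
rewrite (@continuous_FTC2 _ _ F) //.
- by rewrite /F -EFinB opprK addrC mulrBl.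
- apply: continuous_subspaceT; exact: (cF _ _ (dX b)).
- split => [t _||]; first by have [] := dF t.
    by apply: cvg_at_right_filter; exact: (cF _ _ dF).
  by apply: cvg_at_left_filter; exact: (cF _ _ dF).
- by move=> t _; rewrite derive1E; have [] := dF t.
Qed.

Lemma measurable_count_le (R : realType) (s : seq R) :
  measurable_fun [set: R] (fun x => (count (fun y => y <= x) s)%:R : R).
Proof.
elim: s => [|y s IH] /=; first exact: measurable_cst.
have -> : (fun x => ((y <= x)%R + count (fun y => y <= x) s)%:R) =
    (\1_`[y, +oo[ \+ (fun x => (count (fun y => y <= x) s)%:R)) :> (R -> R).
  by apply/funext => x /=; rewrite natrD indicE mem_setE in_itv /= andbT.
exact: measurable_funD.
Qed.

(** Induction on the sorted sample: below its least point y the count is 0, and beyond y that point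
    contributes a constant [d], absorbed into [c]. This is why [c] and [lo] are arbitrary; the
    intended values are c = lo = 0 and d = 1/n. *)
Lemma integral_empirical (R : realType) (s : seq R) (lo c d : R) (b : nat) :
  ~~ odd b -> sorted <=%R s -> all (fun y => lo <= y <= 1) s -> lo <= 1 ->
  (\int[lebesgue_measure]_(x in `[lo, 1%R])
     ((c + d * (count (fun y => y <= x) s)%:R - x) ^+ b)%:E =
   (((c - lo) ^+ b.+1
     + \sum_(i < size s)
         ((c + d * i.+1%:R - s`_i) ^+ b.+1 - (c + d * i%:R - s`_i) ^+ b.+1)
     - (c + d * (size s)%:R - 1) ^+ b.+1) / b.+1%:R)%:E)%E.
Proof.
move=> b_ev; elim: s lo c => [|y s IH] lo c /=.
  move=> _ _ lo1; rewrite mulr0 addr0 big_ord0 addr0.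
  exact: integral_itv_shifted_expr.
move=> sorted_ys /andP[/andP[loy y1] s_all] lo1.
have y_min : all (<=%R y) s by apply: order_path_min sorted_ys; exact: le_trans.
(* The cut is half-open because the count already includes y at x = y. *)
rewrite (@itv_bndbnd_setU _ _ (BLeft lo) (BLeft y)) ?bnd_simp //.
rewrite ge0_integral_setU //=; last 3 first.
- apply/measurable_EFinP/measurable_funTS; apply: measurable_funX.
  apply: measurable_funB => //; apply: measurable_funD => //.
  apply: measurable_funM => //.
  exact: (measurable_count_le _ (y :: s)).
- by move=> x _; rewrite lee_fin exprn_even_ge0.
- apply/disj_setPS => x [] /=; rewrite !in_itv /= => /andP[_ xy] /andP[yx _].
  by move: xy; rewrite ltNge yx.
rewrite [X in (X + _)%E](_ : _ =
    (\int[lebesgue_measure]_(x in `[lo, y[) ((c - x) ^+ b)%:E)%E); last first.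
  apply: eq_integral => x; rewrite inE /= in_itv /= => /andP[_ xy].
  rewrite leNgt xy add0n (_ : count _ _ = 0%N) ?mulr0 ?addr0 //.
  apply/eqP; rewrite -leqn0 leqNgt -has_count; apply/hasPn => z zs.
  by rewrite -ltNge (lt_le_trans xy) //; exact: (allP y_min).
rewrite [X in (_ + X)%E](_ : _ =
    (\int[lebesgue_measure]_(x in `[y, 1%R])
      (((c + d) + d * (count (fun z => z <= x) s)%:R - x) ^+ b)%:E)%E); last first.
  apply: eq_integral => x; rewrite inE /= in_itv /= => /andP[yx _].
  by rewrite yx natrD mulrDr mulr1 addrA.
rewrite integral_itv_bndo_bndc; last first.
  apply/measurable_EFinP/measurable_funTS; apply: measurable_funX.
  exact: measurable_funB.
rewrite integral_itv_shifted_expr // IH //; last 2 first.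
- exact: path_sorted sorted_ys.
- apply/allP => z zs; rewrite (allP y_min) //=.
  by have /andP[] := allP s_all z zs.
rewrite -EFinD; congr EFin; rewrite big_ord_recl /= mulr0 addr0 mulr1.
have shift k : c + d * k.+1%:R = c + d + d * k%:R by rewrite -natr1; ring.
rewrite shift; under [in RHS]eq_bigr => i _ do rewrite /bump leq0n add1n !shift.
by rewrite -mulrDl; congr (_ / _); ring.
Qed.

(** * Integrals of polynomials over the unit interval *)

Definition int01 (R : realType) (p : {poly R}) : R :=
  \int[lebesgue_measure]_(x in `[0, 1]) p.[x].

Lemma integrable01_horner (R : realType) (p : {poly R}) :
  lebesgue_measure.-integrable `[0, 1] (EFin \o (fun x => p.[x])).
Proof.
apply: continuous_compact_integrable; first exact: segment_compact.
exact/continuous_subspaceT/continuous_horner.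
Qed.

Lemma EFin_int01 (R : realType) (p : {poly R}) :
  ((int01 R p)%:E = \int[lebesgue_measure]_(x in `[0%R, 1%R]) (p.[x])%:E)%E.
Proof. by rewrite fineK //; exact/integrable_fin_num/integrable01_horner. Qed.

Lemma int01D (R : realType) (p q : {poly R}) : int01 R (p + q) = int01 R p + int01 R q.
Proof.
rewrite -RintegralD //; [|exact: integrable01_horner..].
by apply: eq_Rintegral => x _; rewrite hornerD.
Qed.

Lemma int01Z (R : realType) (c : R) (p : {poly R}) : int01 R (c *: p) = c * int01 R p.
Proof.
rewrite -RintegralZl //; last exact: integrable01_horner.
by apply: eq_Rintegral => x _; rewrite hornerZ.
Qed.

Lemma int01_0 (R : realType) : int01 R 0 = 0.
Proof. by rewrite -(scale0r 0) int01Z mul0r. Qed.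

Lemma int01_horner_natr (R : realType) (q : {poly {poly R}}) (n : nat) :
  int01 R q.[n%:R] = \sum_(i < size q) n%:R ^+ i * int01 R q`_i.
Proof.
rewrite horner_coef (big_morph _ (int01D R) (int01_0 R)).
apply: eq_bigr => i _; rewrite -int01Z; congr int01.
by rewrite -!natrX mulr_natr scaler_nat.
Qed.

(** This is the beta function at (m + 1, m + 1). *)
Lemma int01_beta (R : realType) (m : nat) :
  int01 R (('X * (1 - 'X)) ^+ m) = (m`! * m`!)%:R / (m.*2.+1)`!%:R.
Proof.
rewrite -addnn -beta_fun_fact /beta_fun -Rintegral_mkcond.
by apply: eq_Rintegral => x _; rewrite !hornerE exprMn.
Qed.

(** * Uniform marginals and the counting function of the sample *)

Lemma uniform01_le (d : measure_display) (T : measurableType d) (R : realType)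
    (P : probability T R) (Y : {RV P >-> R}) (x : R) :
  uniform01 Y -> 0 <= x <= 1 -> P (Y @^-1` `]-oo, x]) = x%:E.
Proof.
move=> uY /andP[x0 x1]; rewrite -[LHS]/(distribution P Y _) uY //.
rewrite /uniform_prob integral_uniform_pdf (_ : _ `&` _ = `[0, x]%classic); last first.
  apply/seteqP; split => y /=; rewrite !in_itv /=; first by move=> [? /andP[-> _]].
  by move=> /andP[-> yx]; rewrite yx (le_trans yx).
rewrite (eq_integral (cst 1%E)); last first.
  move=> y; rewrite inE /= in_itv /= => /andP[y0 yx].
  by rewrite /uniform_pdf y0 (le_trans yx) // subr0 invr1.
rewrite integral_cst //= mul1e lebesgue_measure_itv /= lte_fin.
by case: ltgtP x0 => // [_ _|<- _]; rewrite ?oppr0 ?adde0 // -EFinB subr0.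
Qed.

Lemma uniform01_gt (d : measure_display) (T : measurableType d) (R : realType)
    (P : probability T R) (Y : {RV P >-> R}) (x : R) :
  uniform01 Y -> 0 <= x <= 1 -> P (Y @^-1` `]x, +oo[) = (1 - x)%:E.
Proof.
move=> uY x01; rewrite EFinB -(uniform01_le _ _ _ _ _ _ uY x01) -probability_setC.
  by rewrite preimage_setC setCitvl.
by rewrite -[_ @^-1` _]setTI; exact: measurable_funP.
Qed.

(** [uniform01] constrains only the law, so a sample point may leave [0, 1] on a null event;
    identities that need the points inside hold almost surely. *)
Lemma uniform01_ae01 (d : measure_display) (T : measurableType d) (R : realType)
    (P : probability T R) (Y : {RV P >-> R}) :
  uniform01 Y -> \forall w \ae P, 0 <= Y w <= 1.
Proof.
move=> uY; exists (Y @^-1` (~` `[0, 1]%classic)); split.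
- rewrite -[_ @^-1` _]setTI; apply: measurable_funP => //; exact: measurableC.
- rewrite -[LHS]/(distribution P Y _) uY; last exact: measurableC.
  by rewrite /uniform_prob integral_uniform_pdf setICl integral_set0.
- by move=> w /= h; rewrite in_itv.
Qed.

(** This is n F x, written as the size of an index set so that events can be split according to that
    set, as in the sum defining [cmoment]. *)
Definition count_le (T : Type) (R : realType) (n : nat)
    (Y : 'I_n -> T -> R) (x : R) (w : T) : nat :=
  #|[set j | Y j w <= x]%SET|.

(** Measurability is joint in the outcome and the threshold, as Tonelli requires. *)
Lemma measurable_count_le2 (d : measure_display) (T : measurableType d) (R : realType)
    (n : nat) (Y : 'I_n -> T -> R) :
  (forall j, measurable_fun [set: T] (Y j)) ->
  measurable_fun [set: T * R] (fun z => (count_le T R n Y z.2 z.1)%:R : R).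
Proof.
move=> mY.
have -> : (fun z => (count_le T R n Y z.2 z.1)%:R : R) =
    (fun z : T * R => \sum_(j < n) (if Y j z.1 <= z.2 then 1 else 0 : R)).
  apply/funext => z; rewrite /count_le -sum1_card natr_sum big_mkcond /=.
  by apply: eq_bigr => j _; rewrite inE.
apply: measurable_sum => j; apply: measurable_fun_ifT => //.
by apply: measurable_fun_ler => //; apply: measurableT_comp.
Qed.

(** * Expected integral of the powers of F x - x *)

Section sample.
Context (d : measure_display) (T : measurableType d) (R : realType)
  (P : probability T R) (n : nat) (Y : 'I_n -> {RV P >-> R}).
Hypotheses (indep : mutually_independent Y) (unif : forall i, uniform01 (Y i)).

Let below (x : R) (S : {set 'I_n}) (j : 'I_n) : set R :=
  if j \in S then `]-oo, x]%classic else `]x, +oo[%classic.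

Let below_measurable x S j : measurable (below x S j).
Proof. by rewrite /below; case: ifP. Qed.

(* The event that S is the set of indices of the sample points below x. *)
Let pattern x S : set T := \bigcap_(j in [set` [set: 'I_n]%SET]) (Y j @^-1` below x S j).

Let patternE x S w : pattern x S w <-> [set j | Y j w <= x]%SET = S.
Proof.
rewrite /pattern /below; split => [h|<- j _ /=].
  apply/setP => j; rewrite inE; have /= := h j; rewrite inE => /(_ isT).
  case: ifP => _; rewrite /= in_itv /= ?andbT; first by move=> ->.
  by rewrite ltNge => /negbTE.
by rewrite inE; case: ifP => jx; rewrite /= in_itv /= ?jx // andbT ltNge jx.
Qed.

Let pattern_measurable x S : measurable (pattern x S).
Proof.
rewrite /pattern; apply: fin_bigcap_measurable => // j _.
by rewrite -[_ @^-1` _]setTI; exact: measurable_funP.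
Qed.

Let pattern_prob x S : 0 <= x <= 1 ->
  P (pattern x S) = (x ^+ #|S| * (1 - x) ^+ (n - #|S|))%:E.
Proof.
move=> x01; rewrite /pattern indep; last by move=> j; exact: below_measurable.
transitivity (\prod_(j < n) (if j \in S then x else 1 - x)%:E)%E.
  rewrite [LHS](eq_bigl xpredT); last by move=> j; rewrite inE.
  apply: eq_bigr => j _; rewrite /below; case: ifP => _.
  - exact: uniform01_le.
  - exact: uniform01_gt.
rewrite prodEFin big_if /= !prodr_const; congr (_ * _ ^+ _)%:E.
transitivity (#|~: S|)%N; first by apply: eq_card => j; rewrite !inE.
by have := cardsC S; rewrite card_ord; move: #|S| #|~: S| => k l <-; rewrite addKn.
Qed.

(** The patterns partition the probability space, so exactly one indicator is nonzero at each
    outcome, and independence gives the probability of each pattern. *)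
Lemma integral_count_le (g : nat -> R) (x : R) :
  (forall k, 0 <= g k) -> 0 <= x <= 1 ->
  (\int[P]_w (g (count_le _ _ n (fun j => Y j : T -> R) x w))%:E =
   (\sum_(S : {set 'I_n}) x ^+ #|S| * (1 - x) ^+ (n - #|S|) * g #|S|)%:E)%E.
Proof.
move=> g0 x01.
transitivity (\int[P]_w (\sum_(S : {set 'I_n}) (g #|S|)%:E * (\1_(pattern x S) w)%:E))%E.
  apply: eq_integral => w _; rewrite (bigD1 [set j | Y j w <= x]%SET) //= big1 ?adde0.
    by rewrite indicE mem_set ?mule1 //; apply/patternE.
  move=> S /negP SY; rewrite indicE memNset ?mule0 // => /patternE YS.
  by apply: SY; rewrite YS.
rewrite ge0_integral_sum //; last 2 first.
- move=> S; apply: measurable_funeM; apply/measurable_EFinP; exact: measurable_indic.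
- by move=> S w _; rewrite mule_ge0 // lee_fin.
rewrite -sumEFin; apply: eq_bigr => S _.
rewrite ge0_integralZl_EFin //; last by apply/measurable_EFinP; exact: measurable_indic.
by rewrite integral_indic // setIT [X in (_ * X)%E](pattern_prob _ S x01) -EFinM mulrC.
Qed.

Let sq (b : nat) (z : T * R) : \bar R :=
  ((n%:R^-1 * (count_le _ _ n (fun j => Y j : T -> R) z.2 z.1)%:R - z.2) ^+ b)%:E.

Let sq_measurable b : measurable_fun [set: T * R] (sq b).
Proof.
apply/measurable_EFinP; apply: measurable_funX; apply: measurable_funB => //.
apply: measurable_funM => //; exact: measurable_count_le2.
Qed.

Let sq_ge0 b z : ~~ odd b -> (0 <= sq b z)%E.
Proof. by move=> ?; rewrite lee_fin exprn_even_ge0. Qed.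

(** Trades the restricted Lebesgue integral for one over the whole line against a probability, the
    form in which Tonelli is applied. *)
Let integral01_sq b w : ~~ odd b ->
  (\int[lebesgue_measure]_(x in `[0%R, 1%R]) sq b (w, x) =
   \int[uniform_prob (@ltr01 R)]_x sq b (w, x))%E.
Proof.
move=> b_ev; rewrite integral_uniform.
- by rewrite subr0 invr1 mul1e.
- exact: measurableT_comp (sq_measurable b) (pair1_measurable w).
- by move=> x; exact: sq_ge0.
Qed.

Lemma measurable_integral_empirical b : ~~ odd b ->
  measurable_fun [set: T] (fun w => (\int[lebesgue_measure]_(x in `[0%R, 1%R])
    ((n%:R^-1 * (count_le _ _ n (fun j => Y j : T -> R) x w)%:R - x) ^+ b)%:E)%E).
Proof.
move=> b_ev.
have -> : (fun w =>
    (\int[lebesgue_measure]_(x in `[0%R, 1%R]) sq b (w, x))%E) =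
    fubini_F (uniform_prob (@ltr01 R)) (sq b).
  by apply/funext => w; exact: integral01_sq.
apply: measurable_fun_fubini_tonelli_F; first exact: sq_measurable.
by move=> z; exact: sq_ge0.
Qed.

Lemma integral_integral_empirical b : ~~ odd b -> (0 < n)%N ->
  (\int[P]_w \int[lebesgue_measure]_(x in `[0%R, 1%R])
    ((n%:R^-1 * (count_le _ _ n (fun j => Y j : T -> R) x w)%:R - x) ^+ b)%:E =
   (n%:R ^- b * int01 R (cmoment R n b))%:E)%E.
Proof.
move=> b_ev n0; transitivity (\int[P]_w \int[uniform_prob (@ltr01 R)]_x sq b (w, x))%E.
  by apply: eq_integral => w _; exact: integral01_sq.
(* After the exchange x is fixed under the expectation, and n F x is a binomial count. *)
rewrite fubini_tonelli; last 2 first.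
- exact: sq_measurable.
- by move=> z; exact: sq_ge0.
rewrite integral_uniform; last 2 first.
- apply: (measurable_fun_fubini_tonelli_G (m1 := P) (sq b)) => // z; exact: sq_ge0.
- by move=> x; apply: integral_ge0 => w _; exact: sq_ge0.
rewrite subr0 invr1 mul1e -int01Z EFin_int01; apply: eq_integral => x.
rewrite inE /= in_itv /= => x01.
rewrite (integral_count_le (fun k => (n%:R^-1 * k%:R - x) ^+ b)) //; last first.
  by move=> k; rewrite /= exprn_even_ge0.
rewrite hornerZ horner_sum mulr_sumr; congr EFin; apply: eq_bigr => S _.
have -> : n%:R^-1 * #|S|%:R - x = n%:R^-1 * (#|S|%:R - n%:R * x).
  by rewrite mulrBr mulrA mulVf ?mul1r // pnatr_eq0 -lt0n.
rewrite !hornerE !hornerMn hornerC exprMn exprVn.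
by rewrite /=; move: (n%:R ^- b) => v; ring.
Qed.

End sample.

(** * Order statistics through counts *)

Lemma sorted_nth_le (R : realType) (s : seq R) (k : nat) (x : R) :
  sorted <=%R s -> (k < size s)%N ->
  (s`_k <= x) = (k < count (fun y => (y <= x)%R) s)%N.
Proof.
elim: s k => [|y s IH] k //= sorted_ys ks.
have y_min : all (<=%R y) s by apply: order_path_min sorted_ys; exact: le_trans.
have [yx|xy] := boolP (y <= x).
  by case: k ks => //= k ks; rewrite IH // (path_sorted sorted_ys).
rewrite add0n (_ : count _ _ = 0%N); last first.
  apply/eqP; rewrite -leqn0 leqNgt -has_count; apply/hasPn => z zs.
  by apply: contra xy; exact/le_trans/(allP y_min).
case: k ks => [|k] /= ks; first exact/negbTE.
apply/negbTE; apply: contra xy; apply: le_trans.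
by apply: (allP y_min); exact: mem_nth.
Qed.

Lemma count_sort_sample (T : Type) (R : realType) (n : nat)
    (Y : 'I_n -> T -> R) (x : R) (w : T) :
  count (fun y => y <= x) (sort <=%R [seq Y j w | j <- enum 'I_n]) = count_le T R n Y x w.
Proof.
rewrite count_sort count_map /count_le -sum1_card -sum1_count big_enum_cond /=.
by apply: eq_bigl => j; rewrite inE.
Qed.

Lemma order_stat_le (T : Type) (R : realType) (n : nat)
    (Y : 'I_n -> T -> R) (i : 'I_n) (x : R) (w : T) :
  (order_stat Y i.+1 w <= x) = (i < count_le T R n Y x w)%N.
Proof.
rewrite -count_sort_sample /order_stat /= sorted_nth_le //.
  by apply: sort_sorted; exact: le_total.
by rewrite size_sort size_map size_enum_ord.
Qed.

(** The rays ]x, +oo[ generate the Borel sets, and such a ray pulls back to the event that at most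
    [i] points lie below or at x. *)
Lemma measurable_order_stat (d : measure_display) (T : measurableType d) (R : realType)
    (n : nat) (Y : 'I_n -> T -> R) (i : 'I_n) :
  (forall j, measurable_fun [set: T] (Y j)) ->
  measurable_fun [set: T] (order_stat Y i.+1).
Proof.
move=> mY mT; apply: (measurability _ (RGenOInfty.measurableE R)) => //.
move=> /= _ [_ [x ->] <-].
have mcount : measurable_fun [set: T] (fun w => (count_le T R n Y x w)%:R : R).
  exact: measurableT_comp (measurable_count_le2 _ _ _ _ _ mY) (pair2_measurable x).
rewrite [X in measurable X](_ : _ = [set: T] `&`
    (fun w => (count_le T R n Y x w)%:R : R) @^-1` `]-oo, i.+1%:R[%classic).
  by apply: mcount => //; exact: measurable_itv.
congr (_ `&` _); apply/seteqP.
by split => w /=; rewrite !in_itv /= andbT ltr_nat ltNge order_stat_le ltnS -leqNgt.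
Qed.

(** * Expected displacement against expected cell means *)

Section sample_displacement.
Context (d : measure_display) (T : measurableType d) (R : realType)
  (P : probability T R) (n : nat) (Y : 'I_n -> {RV P >-> R}).
Hypotheses (indep : mutually_independent Y) (unif : forall i, uniform01 (Y i))
  (n_gt0 : (0 < n)%N).

Let dev (i : 'I_n) (w : T) : R :=
  order_stat (fun j => Y j : T -> R) i.+1 w - anchor R n i.+1.
(** Half the length of a cell: [anchor R n i.+1] plus or minus [h] are the endpoints of the cell
    [i/n, (i+1)/n]. *)
Let h : R := 1 / (2 * n%:R).

Let n0 : 0 < n%:R :> R. Proof. by rewrite ltr0n. Qed.
Let h_gt0 : 0 < h. Proof. by rewrite /h divr_gt0 // mulr_gt0. Qed.

(** [integral_empirical] at c = lo = 0, d = 1/n: each sample point contributes the mean over its own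
    cell, divided by n. *)
Let integral_empirical_cell_mean b w : ~~ odd b -> (forall j, 0 <= Y j w <= 1) ->
  (\int[lebesgue_measure]_(x in `[0%R, 1%R])
     ((n%:R^-1 * (count_le _ _ n (fun j => Y j : T -> R) x w)%:R - x) ^+ b)%:E =
   (n%:R^-1 * \sum_(i < n) cell_mean R b (dev i w) h)%:E)%E.
Proof.
move=> b_ev Y01; pose s := sort <=%R [seq Y j w | j <- enum 'I_n].
have size_s : size s = n by rewrite size_sort size_map size_enum_ord.
transitivity (\int[lebesgue_measure]_(x in `[0%R, 1%R])
    ((0 + n%:R^-1 * (count (fun y => (y <= x)%R) s)%:R - x) ^+ b)%:E)%E.
  apply: eq_integral => x _; rewrite add0r /s.
  by rewrite (count_sort_sample _ _ n (fun j => Y j : T -> R)).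
rewrite integral_empirical //; last 2 first.
- by apply: sort_sorted; exact: le_total.
- by rewrite all_sort all_map; apply/allP => j _; exact: Y01.
(* Both boundary terms vanish: the one at 0 since c = lo, the one at 1 since n/n = 1. *)
congr EFin; rewrite size_s !add0r mulVf ?gt_eqF // !subrr oppr0 !expr0n /= add0r subr0.
rewrite mulr_suml mulr_sumr; apply: eq_bigr => i _; rewrite !add0r.
rewrite /cell_mean (_ : 2 * h = n%:R^-1); last by rewrite /h; field; rewrite gt_eqF.
have -> : dev i w + h = - (n%:R^-1 * i%:R - s`_i).
  by rewrite /dev /h /order_stat /anchor /= -natr1; field; rewrite gt_eqF.
have -> : dev i w - h = - (n%:R^-1 * i.+1%:R - s`_i).
  by rewrite /dev /h /order_stat /anchor /= -natr1; field; rewrite gt_eqF.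
(* The differences are point minus endpoint in [cell_mean] but endpoint minus point here; the odd
   exponent b + 1 turns this into a sign. *)
have oddN (z : R) : (- z) ^+ b.+1 = - z ^+ b.+1.
  by rewrite exprNn -signr_odd /= b_ev expr1 mulN1r.
rewrite !oddN.
by field; rewrite gt_eqF //= pnatr_eq0.
Qed.

Let measurable_dev i : measurable_fun [set: T] (dev i).
Proof. by apply: measurable_funB => //; exact: measurable_order_stat. Qed.

Let measurable_cell b i : measurable_fun [set: T] (fun w => cell_mean R b (dev i w) h).
Proof.
rewrite /cell_mean; apply: measurable_funM => //.
by apply: measurable_funB; apply: measurable_funX;
  [apply: measurable_funD|apply: measurable_funB].
Qed.

Lemma integral_sum_cell_mean b : ~~ odd b ->
  (\int[P]_w (\sum_(i < n) cell_mean R b (dev i w) h)%:E =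
   (n%:R * (n%:R ^- b * int01 R (cmoment R n b)))%:E)%E.
Proof.
move=> b_ev; rewrite EFinM.
rewrite -(integral_integral_empirical _ _ _ _ _ _ indep unif _ b_ev n_gt0).
rewrite -ge0_integralZl_EFin ?ler0n //; last 2 first.
- by move=> w _; apply: integral_ge0 => x _; rewrite lee_fin exprn_even_ge0.
- exact: measurable_integral_empirical.
apply: ae_eq_integral => //.
- apply/measurable_EFinP; exact: measurable_sum.
- by apply: measurable_funeM; exact: measurable_integral_empirical.
have : \forall w \ae P, forall j, 0 <= Y j w <= 1.
  by apply: filter_forall => j; exact: uniform01_ae01.
apply: filterS => w Y01 _; rewrite integral_empirical_cell_mean // -EFinM.
by rewrite mulrA mulfV ?mul1r // gt_eqF.
Qed.


Lemma expected_displacementE b : ~~ odd b ->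
  expected_displacement b Y = (\int[P]_w (\sum_(i < n) dev i w ^+ b)%:E)%E.
Proof.
move=> b_ev; rewrite /expected_displacement big_add1 /= big_mkord.
under [RHS]eq_integral do rewrite -sumEFin.
rewrite ge0_integral_sum //; last 2 first.
- by move=> i; apply/measurable_EFinP; exact: measurable_funX.
- by move=> i w _; rewrite lee_fin exprn_even_ge0.
apply: eq_bigr => i _; rewrite unlock; apply: eq_integral => w _.
by rewrite -normrX ger0_norm ?exprn_even_ge0.
Qed.

Let measurable_sum_devX b :
  measurable_fun [set: T] (fun w => (\sum_(i < n) dev i w ^+ b)%:E).
Proof. by apply/measurable_EFinP; apply: measurable_sum => i; exact: measurable_funX. Qed.

Let measurable_sum_cell b :
  measurable_fun [set: T] (fun w => (\sum_(i < n) cell_mean R b (dev i w) h)%:E).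
Proof. by apply/measurable_EFinP; apply: measurable_sum. Qed.

Let sum_devX_ge0 b w : ~~ odd b -> 0 <= \sum_(i < n) dev i w ^+ b.
Proof. by move=> b_ev; apply: sumr_ge0 => i _; rewrite exprn_even_ge0. Qed.

Lemma expected_displacement_ge0 b : ~~ odd b -> (0 <= expected_displacement b Y)%E.
Proof.
move=> b_ev; rewrite expected_displacementE //.
by apply: integral_ge0 => w _; rewrite lee_fin sum_devX_ge0.
Qed.

Lemma expected_displacement_le b : ~~ odd b ->
  (expected_displacement b Y <= (n%:R * (n%:R ^- b * int01 R (cmoment R n b)))%:E)%E.
Proof.
move=> b_ev; rewrite expected_displacementE // -integral_sum_cell_mean //.
apply: ge0_le_integral => //.
  by move=> w _; rewrite lee_fin sum_devX_ge0.
by move=> w _; rewrite lee_fin; apply: ler_sum => i _; exact: cell_mean_ge.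
Qed.

(** The error term involves the displacement for the exponent lowered by 2, which
    [expected_displacement_le] in turn controls. *)
Lemma expected_displacement_ge (m : nat) (K : R) : 0 <= K ->
  (forall y : R, cell_mean R m.+1.*2 y h <=
     y ^+ m.+1.*2 + K * h ^+ 2 * (y ^+ m.*2 + h ^+ m.*2)) ->
  ((n%:R * (n%:R ^- m.+1.*2 * int01 R (cmoment R n m.+1.*2)))%:E <=
   expected_displacement m.+1.*2 Y +
   (K * h ^+ 2)%:E * (expected_displacement m.*2 Y + (n%:R * h ^+ m.*2)%:E))%E.
Proof.
move=> K0 cell_le.
have Kh0 : 0 <= K * h ^+ 2 by rewrite mulr_ge0 // exprn_ge0 // ltW.
have hm0 : 0 <= n%:R * h ^+ m.*2 by rewrite mulr_ge0 ?exprn_ge0 // ltW.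
rewrite !expected_displacementE ?odd_double // -integral_sum_cell_mean ?odd_double //.
have -> : (n%:R * h ^+ m.*2)%:E = (\int[P]_w (cst (n%:R * h ^+ m.*2)%:E w))%E.
  by rewrite integral_cst //= probability_setT mule1.
rewrite -ge0_integralD //; last first.
  by move=> w _; rewrite lee_fin sum_devX_ge0 ?odd_double.
rewrite -ge0_integralZl_EFin //; last 2 first.
- by move=> w _; rewrite adde_ge0 // lee_fin sum_devX_ge0 ?odd_double.
- exact: emeasurable_funD.
rewrite -ge0_integralD //; last 3 first.
- by move=> w _; rewrite lee_fin sum_devX_ge0 ?odd_double.
- by move=> w _; rewrite mule_ge0 ?lee_fin ?addr_ge0 ?sum_devX_ge0 ?odd_double.
- by apply: measurable_funeM; exact: emeasurable_funD.
apply: ge0_le_integral => //.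
- move=> w _; rewrite lee_fin; apply: sumr_ge0 => i _.
  by apply: le_trans (cell_mean_ge _ _ _ _ _ _); rewrite ?exprn_even_ge0 ?odd_double.
- by apply: emeasurable_funD => //; apply: measurable_funeM; exact: emeasurable_funD.
move=> w _.
(* The same inequality up to conversion, with the finite extended reals gathered under one
   [EFin]. *)
change ((\sum_(i < n) cell_mean R m.+1.*2 (dev i w) h)%:E <=
  (\sum_(i < n) dev i w ^+ m.+1.*2 +
   K * h ^+ 2 * (\sum_(i < n) dev i w ^+ m.*2 + n%:R * h ^+ m.*2))%:E)%E.
rewrite lee_fin.
have -> : n%:R * h ^+ m.*2 = \sum_(i < n) h ^+ m.*2.
  by rewrite sumr_const card_ord mulr_natl.
rewrite -big_split /= mulr_sumr -big_split /=.
by apply: ler_sum => i _; exact: cell_le.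
Qed.

End sample_displacement.

(** * Asymptotics in n *)

(** The identity (2m - 1)!! 2^m m! = (2m)! simplifies (2m - 1)!! m!^2 / (2m + 1)! to the constant of
    the theorem for m = a/2. *)
Lemma int01_double_fact (R : realType) (m : nat) :
  int01 R ((double_fact m)%:R * ('X * (1 - 'X)) ^+ m) =
  m`!%:R / (2 ^+ m * (1 + m.*2%:R)).
Proof.
rewrite mulr_natl -scaler_nat int01Z int01_beta factS.
have f0 k : k`!%:R != 0 :> R by rewrite pnatr_eq0 -lt0n fact_gt0.
have two0 : 2 ^+ m != 0 :> R by rewrite expf_neq0 // pnatr_eq0.
have E : (double_fact m)%:R * (2 ^+ m * m`!%:R) = m.*2`!%:R :> R.
  by rewrite -natrX -!natrM double_factE.
rewrite !natrM -E -natr1 [in RHS]addrC.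
have d0 : (double_fact m)%:R != 0 :> R.
  by apply: contraNneq (f0 m.*2) => d0; rewrite -E d0 mul0r.
by field; rewrite two0 f0 d0 /= natr1 pnatr_eq0.
Qed.

(** The coefficient of n^m gives the main term; for j < m, the term in n^j becomes one in
    n^(j+1-2m), at most n^(-m). Writing n / n^m covers m = 0 as well. *)
Lemma mean_integral_asymptotics (R : realType) (m : nat) :
  exists2 C : R, 0 <= C & forall n : nat, (0 < n)%N ->
    `|n%:R * (n%:R ^- m.*2 * int01 R (cmoment R n m.*2)) -
      m`!%:R / (2 ^+ m * (1 + m.*2%:R)) * (n%:R / n%:R ^+ m)| <= C / n%:R ^+ m.
Proof.
have [q [size_q lead_q cmomentE]] := cmoment_poly R m.*2.
rewrite doubleK odd_double in size_q lead_q.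
exists (\sum_(j < m) `|int01 R q`_j|) => [|n n_gt0]; first exact: sumr_ge0.
have n0 : 0 < n%:R :> R by rewrite ltr0n.
have nm0 : 0 < n%:R ^+ m :> R by rewrite exprn_gt0.
rewrite cmomentE int01_horner_natr.
(* [size q] is only bounded by m + 1: the sum is padded with zero coefficients before the term of
   index m is split off. *)
rewrite (big_ord_widen _ (fun j => n%:R ^+ j * int01 R q`_j) size_q) big_mkcond /=.
rewrite (eq_bigr (fun j : 'I_m.+1 => n%:R ^+ j * int01 R q`_j)); last first.
  move=> j _; case: ltnP => // sj; rewrite nth_default //.
  by rewrite int01_0 mulr0.
rewrite big_ord_recr /= lead_q // int01_double_fact -addnn exprD.
set S := \sum_(j < m) _; set c := _ / (2 ^+ m * _).
have -> : n%:R * ((n%:R ^+ m * n%:R ^+ m)^-1 * (S + n%:R ^+ m * c)) -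
    c * (n%:R / n%:R ^+ m) = (n%:R * S / n%:R ^+ m) / n%:R ^+ m.
  by field; rewrite gt_eqF.
rewrite normrM [`|_ ^-1|]ger0_norm ?invr_ge0 ?(ltW nm0) //. rewrite ler_pM2r ?invr_gt0 //.
rewrite normrM [`|_ ^-1|]ger0_norm ?invr_ge0 ?(ltW nm0) // ler_pdivrMr //.
rewrite /S mulr_sumr mulr_suml; apply: le_trans (ler_norm_sum _ _ _) _.
apply: ler_sum => j _; rewrite mulrA -exprS normrM mulrC ler_wpM2l //.
by rewrite ger0_norm ?exprn_ge0 ?(ltW n0) // ler_weXn2l // ler1n.
Qed.

Theorem theorem2 (R : realType) (a : nat) (a_gt0 : (0 < a)%N)
    (a_even : ~~ odd a) :
  exists C : R, \forall n \near \oo,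
    forall (d : measure_display) (T : measurableType d) (P : probability T R)
      (Y : 'I_n -> {RV P >-> R}),
      mutually_independent Y ->
      (forall i : 'I_n, uniform01 (Y i)) ->
      (`|expected_displacement a Y -
         ((a./2)`!%:R / (2 ^+ a./2 * (1 + a%:R)) *
            (1 / n%:R ^+ (a./2 - 1)))%:E|
       <= (C * (1 / n%:R ^+ a./2))%:E)%E.
Proof.
have [m am] : exists m, a = m.+1.*2.
  exists a./2.-1; rewrite prednK ?even_halfK //.
  by move: a_gt0 a_even; case: (a) => [|[]].
rewrite {}am {a a_gt0 a_even} doubleK subn1 /=.
have [K K0 cell_bounds] := cell_mean_bounds R m.
have [C C0 HC] := mean_integral_asymptotics R m.+1.
(* With a = 2 (m + 1), this second estimate is for the exponent a - 2 of the error term, which is 0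
   when a = 2. *)
have [C1 C10 HC1] := mean_integral_asymptotics R m.
set c := _ / (2 ^+ m.+1 * _) in HC *; set c1 := _ / (2 ^+ m * _) in HC1.
(* [C] bounds the error of the integrated moment; in the cell error, c1 + C1 comes from the
   displacement of exponent a - 2 and 1 from the power of [h]. *)
exists (C + K * (c1 + C1 + 1)); exists 1%N => // n /= n_gt0 d T P Y indep unif.
have n1 : 1 <= n%:R :> R by rewrite ler1n.
have n0 : 0 < n%:R :> R by rewrite ltr0n.
have nm0 : 0 < n%:R ^+ m :> R by rewrite exprn_gt0.
pose h : R := 1 / (2 * n%:R).
have h0 : 0 < h by rewrite /h divr_gt0 // mulr_gt0.
have := expected_displacement_le _ _ _ _ _ _ indep unif n_gt0 m.*2.
have := expected_displacement_le _ _ _ _ _ _ indep unif n_gt0 m.+1.*2.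
have := expected_displacement_ge0 _ _ _ _ _ Y m.*2.
have := expected_displacement_ge0 _ _ _ _ _ Y m.+1.*2.
rewrite !odd_double => /(_ isT) D0 /(_ isT) D10 /(_ isT) DM /(_ isT) DM1.
have cell_le y : cell_mean R m.+1.*2 y h <=
    y ^+ m.+1.*2 + K * h ^+ 2 * (y ^+ m.*2 + h ^+ m.*2).
  by have /andP[] := cell_bounds y h h0.
have := expected_displacement_ge _ _ _ _ _ _ indep unif n_gt0 m K K0 cell_le.
move: (expected_displacement m.+1.*2 Y) (expected_displacement m.*2 Y) D0 D10 DM DM1.
move: (HC n n_gt0) (HC1 n n_gt0).
move: (n%:R * (n%:R ^- _ * _)) (n%:R * (n%:R ^- _ * _)) => M M1.
(* Both expectations lie between 0 and a real number, so they are finite. *)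
move=> {}HC {}HC1 [D| |] [D1| |] //; rewrite -!EFinM -!EFinD !lee_fin => D0 D10 DM DM1 MD.
rewrite -/h in MD.
have c1_ge0 : 0 <= c1 by rewrite /c1 divr_ge0 ?mulr_ge0 ?exprn_ge0 ?addr_ge0 ?ler0n.
set v := 1 / n%:R ^+ m.+1.
have v0 : 0 < v by rewrite divr_gt0 ?exprn_gt0.
have nv : n%:R * v = 1 / n%:R ^+ m by rewrite /v exprS; field; rewrite !gt_eqF.
have h2 : h ^+ 2 <= 1 / n%:R ^+ 2.
  rewrite /h expr_div_n expr1n ler_pdivrMr ?exprn_gt0 ?mulr_gt0 //.
  by rewrite exprMn mul1r mulrC -mulrA mulfV ?gt_eqF ?exprn_gt0 //; lra.
have h2_ge0 : 0 <= h ^+ 2 by rewrite exprn_ge0 // ltW.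
(* Here [D1] is of order n^(1-m) and h^2 is at most n^(-2), which leaves n^(-(m+1)). *)
have hM : h ^+ 2 * D1 <= (c1 + C1) * v.
  have MD1 : D1 <= (c1 + C1) * (n%:R / n%:R ^+ m).
    have : C1 / n%:R ^+ m <= C1 * (n%:R / n%:R ^+ m).
      by rewrite ler_wpM2l // ler_peMl ?invr_ge0 // ltW.
    by move: HC1; rewrite ler_norml => /andP[_]; lra.
  apply: le_trans (ler_pM h2_ge0 D10 h2 MD1) _.
  rewrite [leLHS](_ : _ = (c1 + C1) * v) //.
  by rewrite /v [n%:R ^+ m.+1]exprS; field; rewrite !gt_eqF.
have hh : h ^+ 2 * (n%:R * h ^+ m.*2) <= v.
  rewrite -mul2n exprM mulrCA -exprS.
  apply: (@le_trans _ _ (n%:R * (1 / n%:R ^+ 2) ^+ m.+1)).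
    by rewrite ler_wpM2l ?(ltW n0) // lerXn2r ?nnegrE // divr_ge0 ?exprn_ge0 ?(ltW n0).
  have -> : (1 / n%:R ^+ 2) ^+ m.+1 = v * v :> R.
    rewrite expr_div_n expr1n -exprM mul2n -addnn exprD /v.
    by field; rewrite gt_eqF ?exprn_gt0.
  rewrite mulrA ler_piMl ?(ltW v0) // nv ler_pdivrMr // mul1r.
  by rewrite exprn_ege1.
have Kh : K * h ^+ 2 * (D1 + n%:R * h ^+ m.*2) <= K * (c1 + C1 + 1) * v.
  rewrite -(mulrA K (h ^+ 2)) -(mulrA K (_ + 1)) ler_wpM2l // (mulrDr (h ^+ 2)).
  by rewrite (mulrDl (c1 + C1)) mul1r lerD.
have -> : c * (1 / n%:R ^+ m) = c * (n%:R / n%:R ^+ m.+1).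
  by rewrite -nv /v mul1r.
have Cv : C / n%:R ^+ m.+1 = C * v by rewrite /v mul1r.
have Kv : 0 <= K * (c1 + C1 + 1) * v by rewrite !mulr_ge0 ?addr_ge0 // ltW.
(* [D] lies between [M] minus the cell error and [M], and [M] is within [C * v] of the main term. *)
move: HC; rewrite Cv !ler_norml mulrDl => /andP[l1 l2]; apply/andP; split; lra.
Qed.
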